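(* Consider a run of the trust-region algorithm described in the context, with its stopping test ignored, and with $\nu_k=\alpha\Delta_k/(1+\|B_k\|(1+\alpha\Delta_k))$ at every iteration. Assume that: (i) there is $\kappa_{\mathrm{mdc}}\in(0,1)$ such that $m(0;x_k,B_k)-m(s_k;x_k,B_k)\ge\kappa_{\mathrm{mdc}}\,\xi_{\mathrm{cp}}(\Delta_k;x_k,\nu_k)$ for all $k$; (ii) there is $\kappa_{\mathrm{ubd}}>0$ such that $|(f+h)(x_k+s_k)-m(s_k;x_k,B_k)|\le\kappa_{\mathrm{ubd}}(1+\|B_k\|)\|s_k\|^2$ for all $k$; (iii) there are $\mu>0$ and $0<p<1$ such that $\max_{0\le j\le k}\|B_j\|\le\mu(1+\sigma_k^p)$ for all $k\in\mathbb N$; (iv) infinitely many iterations are successful (i.e. $\rho_k\ge\eta_1$ for infinitely many $k$); (v) there is $(f+h)_{\mathrm{low}}\in\mathbb R$ such that $(f+h)(x_k)\ge(f+h)_{\mathrm{low}}$ for all $k\in\mathbb N$. Let $\epsilon\in(0,1)$ be small enough that $\mu+1\le\mu|S(\epsilon)|^p$. Then $$|S(\epsilon)|\le\left(2\mu(1+\alpha^{-1}\Delta_{\min}^{-1})\,\frac{(f+h)(x_0)-(f+h)_{\mathrm{low}}}{\eta_1\kappa_{\mathrm{mdc}}\epsilon^2}\right)^{1/(1-p)}=O\!\left(\epsilon^{-2/(1-p)}\right).$$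
   Context: Norms and notation: $\|\cdot\|$ is the Euclidean norm on $\mathbb R^n$ and the induced spectral norm on matrices; $\mathbb B$ is the closed Euclidean unit ball; $\overline{\mathbb R}=\mathbb R\cup\{\pm\infty\}$; $\chi(x\mid A)=0$ if $x\in A$ and $+\infty$ otherwise; $|A|$ is the cardinality of $A$. Problem (P): minimize $f(x)+h(x)$ over $x\in\mathbb R^n$ subject to $\ell\le x\le u$, where $\ell\in(\mathbb R\cup\{-\infty\})^n$, $u\in(\mathbb R\cup\{+\infty\})^n$, $\ell\le u$, $f:\mathbb R^n\to\mathbb R$ is continuously differentiable on an open set containing $[\ell,u]$, and $h:\mathbb R^n\to\mathbb R\cup\{+\infty\}$ is proper and lower semicontinuous (lsc). Both may be nonconvex. Subdifferential: for $\phi:\mathbb R^n\to\overline{\mathbb R}$ finite at $\bar x$, $\widehat\partial\phi(\bar x)$ is the set of $v$ with $\liminf_{x\to\bar x,x\ne\bar x}\frac{\phi(x)-\phi(\bar x)-v^T(x-\bar x)}{\|x-\bar x\|}\ge0$; $\partial\phi(\bar x)$ is the set of $v$ for which there are $x_k\to\bar x$, $v_k\to v$ with $\phi(x_k)\to\phi(\bar x)$ and $v_k\in\widehat\partial\phi(x_k)$. Models: for every $x$ where $h$ is finite, a model $\psi(\cdot;x):\mathbb R^n\to\overline{\mathbb R}$ of $s\mapsto h(x+s)$ is given; it is assumed proper lsc with $\psi(0;x)=h(x)$ and $\partial\psi(0;x)\subseteq\partial h(x)$. Set $\varphi_{\mathrm{cp}}(s;x)=f(x)+\nabla f(x)^Ts$,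 $m_{\mathrm{cp}}(s;x,\nu)=\varphi_{\mathrm{cp}}(s;x)+\tfrac12\nu^{-1}\|s\|^2+\psi(s;x)$, and $m(s;x,B)=f(x)+\nabla f(x)^Ts+\tfrac12s^TBs+\psi(s;x)$ with $B=B^T$. Algorithm: constants $0<\eta_1\le\eta_2<1$, $0<1/\gamma_3\le\gamma_1\le\gamma_2<1<\gamma_3\le\gamma_4$, $\Delta_{\max}>\Delta_0>0$, $\alpha>0$, $\beta\ge1$, tolerance $\epsilon>0$, and $x_0\in[\ell,u]$ with $h(x_0)$ finite. At iteration $k=0,1,\dots$, with a symmetric matrix $B_k$: (1) choose $0<\nu_k\le\frac{\alpha\Delta_k}{1+\|B_k\|(1+\alpha\Delta_k)}$; (2) compute $s_{k,1}\in\operatorname{argmin}_s\,m_{\mathrm{cp}}(s;x_k,\nu_k)+\chi(x_k+s\mid[\ell,u]\cap(x_k+\Delta_k\mathbb B))$ and let $\xi_{\mathrm{cp}}(\Delta_k;x_k,\nu_k)=f(x_k)+h(x_k)-\varphi_{\mathrm{cp}}(s_{k,1};x_k)-\psi(s_{k,1};x_k)$; (3) stopping test: terminate if $\nu_k^{-1/2}\xi_{\mathrm{cp}}(\Delta_k;x_k,\nu_k)^{1/2}\le\epsilon$; (4) compute an approximate minimizer $s_k$ of $m(\cdot;x_k,B_k)$ subject to $x_k+s\in[\ell,u]$, $\|s\|\le\min(\Delta_k,\beta\|s_{k,1}\|)$, meaning a feasible $s_k$ with $m(s_k;x_k,B_k)\le m(s_{k,1};x_k,B_k)$; (5) compute $\rho_k=\frac{(f+h)(x_k)-(f+h)(x_k+s_k)}{m(0;x_k,B_k)-m(s_k;x_k,B_k)}$;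 set $x_{k+1}=x_k+s_k$ if $\rho_k\ge\eta_1$ and $x_{k+1}=x_k$ otherwise; (6) choose $\bar\Delta_{k+1}\in[\gamma_3\Delta_k,\gamma_4\Delta_k]$ if $\rho_k\ge\eta_2$ (very successful), in $[\gamma_2\Delta_k,\Delta_k]$ if $\eta_1\le\rho_k<\eta_2$, in $[\gamma_1\Delta_k,\gamma_2\Delta_k]$ if $\rho_k<\eta_1$ (unsuccessful); set $\Delta_{k+1}=\min(\bar\Delta_{k+1},\Delta_{\max})$. Iteration $k$ is successful if $\rho_k\ge\eta_1$. Further notation: $\sigma_k=|\{j=0,\dots,k\mid\rho_j\ge\eta_1\}|$; $\Delta_{\mathrm{succ}}=\frac{\kappa_{\mathrm{mdc}}(1-\eta_2)}{2\kappa_{\mathrm{ubd}}\alpha\beta^2}$; $\Delta_{\min}=\min(\Delta_0,\gamma_1\Delta_{\mathrm{succ}})$. For $0<\epsilon<1$, $k_\epsilon$ is the first iteration with $\nu_k^{-1/2}\xi_{\mathrm{cp}}(\Delta_k;x_k,\nu_k)^{1/2}\le\epsilon$ ($k_\epsilon=\infty$ if there is none), and $S(\epsilon)=\{k=0,\dots,k_\epsilon-1\mid\rho_k\ge\eta_1\}$. The $O(\cdot)$ is as $\epsilon\downarrow0$ with a constant independent of $\epsilon$. *)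

(* Defs.v *)
(* R^n is represented by the column vectors 'cV[R]_n with R : realType. *)
From HB Require Import structures.
From mathcomp Require Import all_boot all_order all_algebra.
From mathcomp Require Import all_classical all_reals all_analysis.

Set Implicit Arguments.
Unset Strict Implicit.
Unset Printing Implicit Defensive.

Import Order.TTheory GRing.Theory Num.Theory.
Import numFieldNormedType.Exports.

Local Open Scope classical_set_scope.
Local Open Scope ring_scope.

Section Euclidean.
Context {R : realType} {n : nat}.
Implicit Types (u v x s : 'cV[R]_n) (B : 'M[R]_n).

Definition dot u v : R := (u^T *m v) 0 0.

(* The norm `|x| that the library puts on matrices is the sup norm, hence the
   explicit Euclidean norm; both induce the same topology and the same
   differentials. *)
Definition enorm x : R := Num.sqrt (dot x x).

Definition spectral_norm B : R :=
  sup [set enorm (B *m x) | x in [set x | enorm x <= 1]].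

Definition eball x (D : R) : set 'cV[R]_n := [set y | enorm (y - x) <= D].

Definition box (l u : 'I_n -> \bar R) : set 'cV[R]_n :=
  [set x | forall i, (l i <= (x i 0)%:E <= u i)%E].

Definition gradient (f : 'cV[R]_n -> R) x : 'cV[R]_n :=
  \col_i 'D_(delta_mx i 0) f x.

Definition continuously_differentiable_on (f : 'cV[R]_n -> R)
    (U : set 'cV[R]_n) :=
  forall x, U x -> differentiable f x /\ {for x, continuous (gradient f)}.

End Euclidean.

Section VariationalAnalysis.
Context {R : realType} {n : nat}.
Implicit Types (phi : 'cV[R]_n -> \bar R) (x s v : 'cV[R]_n).
Local Open Scope ereal_scope.

Definition proper phi := (forall x, phi x != -oo) /\ (exists x, phi x < +oo).

(* Indicator function of convex analysis. *)
Definition chi x (A : set 'cV[R]_n) : \bar R := if x \in A then 0 else +oo.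

Definition argmin phi : set 'cV[R]_n := [set s | forall t, phi s <= phi t].

(* Regular (Frechet) subdifferential; empty where phi is not finite. *)
Definition regular_subdiff phi x : set 'cV[R]_n :=
  [set v | phi x \is a fin_num /\
    0 <= limf_einf
      (fun y => (phi y - phi x - (dot v (y - x)%R)%:E) / (enorm (y - x)%R)%:E)
      x^'].

(* Limiting (Mordukhovich) subdifferential. *)
Definition subdiff phi x : set 'cV[R]_n :=
  [set v | phi x \is a fin_num /\
    exists xs vs : nat -> 'cV[R]_n,
      [/\ xs @ \oo --> x, vs @ \oo --> v, (phi \o xs) @ \oo --> phi x &
          forall k, regular_subdiff phi (xs k) (vs k)]].

End VariationalAnalysis.

Section Problem.
Context {R : realType} {n : nat}.
Variables (f : 'cV[R]_n -> R) (h : 'cV[R]_n -> \bar R).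
Variables (l u : 'I_n -> \bar R).
(* psi x s is the value at s of the model of s |-> h (x + s). *)
Variable psi : 'cV[R]_n -> 'cV[R]_n -> \bar R.
Implicit Types (x s : 'cV[R]_n) (B : 'M[R]_n) (nu : R).

Definition problem_assumptions :=
  [/\ forall i, (l i != +oo /\ u i != -oo /\ l i <= u i)%E,
      exists U, [/\ open U, box l u `<=` U & continuously_differentiable_on f U],
      proper h &
      lower_semicontinuous h].

Definition model_assumptions :=
  forall x, h x \is a fin_num ->
    [/\ proper (psi x), lower_semicontinuous (psi x), psi x 0 = h x &
        subdiff (psi x) 0 `<=` subdiff h x].

Definition objective x : \bar R := ((f x)%:E + h x)%E.

Definition phi_cp s x : R := f x + dot (gradient f x) s.

Definition m_cp s x nu : \bar R :=
  ((phi_cp s x + 2^-1 * nu^-1 * enorm s ^+ 2)%:E + psi x s)%E.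

Definition m_quad s x B : \bar R :=
  ((f x + dot (gradient f x) s + 2^-1 * dot s (B *m s))%:E + psi x s)%E.

(* s1 is the minimizer s_{k,1} computed for the current radius and nu. *)
Definition xi_cp x s1 : \bar R :=
  (((f x)%:E + h x) - (phi_cp s1 x)%:E - psi x s1)%E.

Definition criticality x nu s1 : \bar R :=
  ((nu `^ (- 2^-1))%:E * poweR (xi_cp x s1) 2^-1)%E.

(* Extended-real quotient. When m 0 = m s the denominator vanishes; the
   library's conventions 0^-1 = +oo and 0 * +oo = 0 give 0 for 0 / 0. *)
Definition rho_ratio x s B : \bar R :=
  ((objective x - objective (x + s)%R) / (m_quad 0%R x B - m_quad s x B))%E.

End Problem.

Record tr_constants (R : realType) := TRConstants {
  eta1 : R; eta2 : R;
  gamma1 : R; gamma2 : R; gamma3 : R; gamma4 : R;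
  Delta_max : R; alpha : R; beta : R }.

Definition admissible_constants (R : realType) (c : tr_constants R) :=
  [/\ 0 < eta1 c /\ eta1 c <= eta2 c < 1,
      0 < (gamma3 c)^-1 /\ (gamma3 c)^-1 <= gamma1 c <= gamma2 c,
      gamma2 c < 1 /\ 1 < gamma3 c <= gamma4 c,
      0 < Delta_max c /\ 0 < alpha c &
      1 <= beta c].

(* Sequences produced by the algorithm; s1k k is s_{k,1}. *)
Record tr_sequences (R : realType) (n : nat) := TRSequences {
  xk : nat -> 'cV[R]_n;
  Bk : nat -> 'M[R]_n;
  nuk : nat -> R;
  Deltak : nat -> R;
  s1k : nat -> 'cV[R]_n;
  sk : nat -> 'cV[R]_n }.

Section Algorithm.
Context {R : realType} {n : nat}.
Variables (f : 'cV[R]_n -> R) (h : 'cV[R]_n -> \bar R).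
Variables (l u : 'I_n -> \bar R).
Variable psi : 'cV[R]_n -> 'cV[R]_n -> \bar R.
Variables (c : tr_constants R) (t : tr_sequences R n).

Definition nu_max (k : nat) : R :=
  alpha c * Deltak t k /
  (1 + spectral_norm (Bk t k) * (1 + alpha c * Deltak t k)).

Definition rhok (k : nat) : \bar R := rho_ratio f h psi (xk t k) (sk t k) (Bk t k).

Definition successful (k : nat) : bool := ((eta1 c)%:E <= rhok k)%E.

Definition very_successful (k : nat) : bool := ((eta2 c)%:E <= rhok k)%E.

Definition xik (k : nat) : \bar R := xi_cp f h psi (xk t k) (s1k t k).

Definition critk (k : nat) : \bar R :=
  criticality f h psi (xk t k) (nuk t k) (s1k t k).

Definition cauchy_step (k : nat) :=
  argmin (fun s => (m_cp f psi s (xk t k) (nuk t k) +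
            chi (xk t k + s)%R (box l u `&` eball (xk t k) (Deltak t k)))%E)
    (s1k t k).

Definition trial_step (k : nat) :=
  [/\ box l u (xk t k + sk t k),
      enorm (sk t k) <= Num.min (Deltak t k) (beta c * enorm (s1k t k)) &
      (m_quad f psi (sk t k) (xk t k) (Bk t k)
        <= m_quad f psi (s1k t k) (xk t k) (Bk t k))%E].

Definition radius_update (k : nat) :=
  let D := Deltak t k in
  exists2 Dbar : R,
    (if very_successful k then gamma3 c * D <= Dbar <= gamma4 c * D
     else if successful k then gamma2 c * D <= Dbar <= D
     else gamma1 c * D <= Dbar <= gamma2 c * D) &
    Deltak t k.+1 = Num.min Dbar (Delta_max c).

(* A run in which the stopping test is never applied. *)
Record tr_run : Prop := TRRun {
  run_init : box l u (xk t 0%N) /\ h (xk t 0%N) \is a fin_num;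
  run_radius0 : 0 < Deltak t 0%N < Delta_max c;
  run_sym : forall k, (Bk t k)^T = Bk t k;
  run_nu : forall k, 0 < nuk t k <= nu_max k;
  run_cauchy : forall k, cauchy_step k;
  run_trial : forall k, trial_step k;
  run_iterate : forall k, xk t k.+1 =
    if successful k then xk t k + sk t k else xk t k;
  run_radius : forall k, radius_update k }.

Definition sigmak (k : nat) : nat := #|[set j : 'I_k.+1 | successful j]%SET|.

(* First iteration at which the criticality measure is at most eps, as an
   extended real: +oo (infimum of the empty set) if there is none. *)
Definition k_eps (eps : R) : \bar R :=
  ereal_inf [set k%:R%:E | k in [set k | (critk k <= eps%:E)%E]].

Definition S_eps (eps : R) : set nat :=
  [set k | (k%:R%:E < k_eps eps)%E /\ successful k].

Definition Delta_succ (kmdc kubd : R) : R :=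
  kmdc * (1 - eta2 c) / (2 * kubd * alpha c * beta c ^+ 2).

Definition Delta_min (kmdc kubd : R) : R :=
  Num.min (Deltak t 0%N) (gamma1 c * Delta_succ kmdc kubd).

End Algorithm.

(* Main.v *)
(** As long as the criticality measure exceeds [eps], we have
    [xi_cp > nu * eps^2 > 0].  The model error is at most a multiple of
    [(1 + ||B||) ||s_{k,1}||^2 <= 2 (1 + ||B||) nu xi_cp <= 2 alpha Delta xi_cp],
    so a radius below [Delta_succ] forces a very successful step and the radius
    never drops below [Delta_min].  This bounds [1 / nu] by
    [(1 + ||B||) (1 + 1 / (alpha Delta_min))], and each successful step
    decreases the objective by at least [eta1 kmdc nu eps^2].  If [M] steps are
    successful up to iteration [k], then [1 + ||B|| <= 2 mu M^p], and summing
    the decreases gives the bound on [M^(1-p)].  Since this holds at every [k]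
    before [k_eps], it also excludes that [S eps] is infinite. *)
Require Import Defs.
From mathcomp Require Import all_boot all_order all_algebra.
From mathcomp Require Import all_classical all_reals all_analysis.
From mathcomp Require Import ring lra.

Set Implicit Arguments.
Unset Strict Implicit.
Unset Printing Implicit Defensive.

Import Order.TTheory GRing.Theory Num.Theory.
Import numFieldNormedType.Exports.

Local Open Scope classical_set_scope.
Local Open Scope ring_scope.

(** * Euclidean and spectral norms *)

Section EuclideanFacts.
Context {R : realType} {n : nat}.
Implicit Types (v x : 'cV[R]_n) (B : 'M[R]_n).

Lemma dotx0 v : dot v 0 = 0.
Proof. by rewrite /dot mulmx0 mxE. Qed.

Lemma enorm_ge0 x : 0 <= enorm x.
Proof. exact: sqrtr_ge0. Qed.

Lemma enorm0 : enorm (0 : 'cV[R]_n) = 0.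
Proof. by rewrite /enorm dotx0 sqrtr0. Qed.

Lemma spectral_norm_ge0 B : 0 <= spectral_norm B.
Proof.
rewrite /spectral_norm; set E := image _ _.
(* [sup] takes the value 0 on a set without a supremum; otherwise the image of 0 is the witness. *)
have [supE|nsupE] := pselect (has_sup E); last by rewrite sup_out.
by apply: (@sup_upper_bound _ _ supE); exists 0; rewrite /= ?mulmx0 ?enorm0.
Qed.

End EuclideanFacts.

(** * Bounds on [nu_max], with [a] for [alpha * Delta] and [b] for the norm of [B] *)

Section StepLength.
Context {R : realType}.
Implicit Types a b : R.

Lemma nu_max_le a b : 0 < a -> 0 <= b ->
  a / (1 + b * (1 + a)) * (1 + b) <= a.
Proof.
move=> a0 b0; have ba0 : 0 <= b * a by rewrite mulr_ge0 // ltW.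
rewrite mulrAC ler_pdivrMr; last by lra.
by rewrite ler_pM2l //; lra.
Qed.

(** The inverse of the right-hand side is [(1 + b) / a + b], which is at most
    [(1 + b0) / a0 + (1 + b0)]. *)
Lemma nu_max_ge a a0 b b0 : 0 < a0 <= a -> 0 <= b <= b0 ->
  ((1 + b0) * (1 + a0^-1))^-1 <= a / (1 + b * (1 + a)).
Proof.
move=> /andP[a0_gt0 le_a0a] /andP[b_ge0 le_bb0].
have a_gt0 : 0 < a by lra.
have -> : a / (1 + b * (1 + a)) = (a^-1 * (1 + b * (1 + a)))^-1.
  by rewrite invfM invrK.
have ai : 0 < a^-1 by rewrite invr_gt0.
have le_inv : a^-1 <= a0^-1 by rewrite lef_pV2 ?posrE.
have ba : 0 <= b * a by rewrite mulr_ge0 // ltW.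
rewrite lef_pV2 ?posrE ?mulr_gt0 //; try lra.
have -> : a^-1 * (1 + b * (1 + a)) = (1 + b) * a^-1 + b.
  by field; rewrite gt_eqF.
have : (1 + b) * a^-1 <= (1 + b0) * a0^-1 by rewrite ler_pM //; lra.
lra.
Qed.

End StepLength.

(** * Finiteness and decrease at the Cauchy step *)

Section Subproblem.
Context {R : realType} {n : nat}.
Variables (f : 'cV[R]_n -> R) (h : 'cV[R]_n -> \bar R).
Variables (l u : 'I_n -> \bar R) (psi : 'cV[R]_n -> 'cV[R]_n -> \bar R).
Implicit Types (x s : 'cV[R]_n) (B : 'M[R]_n).

Lemma m_quad0 x B : psi x 0 = h x -> m_quad f psi 0 x B = objective f h x.
Proof. by move=> p0; rewrite /m_quad mulmx0 !dotx0 mulr0 !addr0 p0. Qed.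

Lemma objective_fin_num x :
  (objective f h x \is a fin_num) = (h x \is a fin_num).
Proof. by rewrite /objective fin_numD. Qed.

Lemma m_quad_fin_num x s B :
  (m_quad f psi s x B \is a fin_num) = (psi x s \is a fin_num).
Proof. by rewrite /m_quad fin_numD. Qed.

(* The step [s = 0] is feasible and has value [f x + h x] in the Cauchy
   subproblem. *)
Lemma cauchy_step_decrease x s1 nu D :
    model_assumptions h psi -> h x \is a fin_num -> box l u x -> 0 <= D ->
    argmin (fun s => (m_cp f psi s x nu +
      chi (x + s)%R (box l u `&` eball x D))%E) s1 ->
  psi x s1 \is a fin_num /\
  exists2 xi : R, xi_cp f h psi x s1 = xi%:E &
    2^-1 * nu^-1 * enorm s1 ^+ 2 <= xi.
Proof.
move=> Hmodel hx bx D0 /(_ 0) /=.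
have [[psiNy _] _ p0 _] := Hmodel x hx.
have -> : chi (x + 0) (box l u `&` eball x D) = 0%E :> \bar R.
  by rewrite /chi mem_set //= addr0; split=> //; rewrite /eball /= subrr enorm0.
rewrite adde0 /m_cp /phi_cp enorm0 expr0n /= mulr0 dotx0 !addr0 p0 /xi_cp.
have := psiNy s1; case: (h x) hx => // hx _.
(* If [psi x s1] were [+oo] or [s1] infeasible, the value at [s1] would be [+oo], above the finite
   value at 0. *)
case: (psi x s1) => [ps|/=|//] _; rewrite /chi; case: ifP => _ //=.
rewrite adde0 lee_fin => le_m; split=> //.
by exists (f x + hx - phi_cp f s1 x - ps) => //; rewrite /phi_cp; lra.
Qed.

End Subproblem.

(** * Feasibility and finiteness along a run *)

Section Run.
Context {R : realType} {n : nat}.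
Variables (f : 'cV[R]_n -> R) (h : 'cV[R]_n -> \bar R).
Variables (l u : 'I_n -> \bar R) (psi : 'cV[R]_n -> 'cV[R]_n -> \bar R).
Variables (c : tr_constants R) (t : tr_sequences R n) (kmdc kubd : R).
Hypothesis Hmodel : model_assumptions h psi.
Hypothesis Hconst : admissible_constants c.
Hypothesis Hrun : tr_run f h l u psi c t.
Hypothesis Hubd : forall k,
  (`| objective f h (xk t k + sk t k)%R
      - m_quad f psi (sk t k) (xk t k) (Bk t k) |
    <= (kubd * (1 + spectral_norm (Bk t k)) * enorm (sk t k) ^+ 2)%:E)%E.

Let F k : R := fine (objective f h (xk t k)).

(** The model at [sk] lies below its finite value at [s1k], and properness excludes [-oo]. The error
    bound then passes finiteness on to the objective, because an infinite gap cannot lie below a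
    real number. *)
Lemma trial_step_fin_num k : box l u (xk t k) -> 0 < Deltak t k ->
    h (xk t k) \is a fin_num ->
  psi (xk t k) (sk t k) \is a fin_num /\ h (xk t k + sk t k) \is a fin_num.
Proof.
move=> bx D0 hx.
have [psis1 _] := cauchy_step_decrease Hmodel hx bx (ltW D0) (run_cauchy Hrun k).
have [_ _ le_m] := run_trial Hrun k.
have [[psiNy _] _ _ _] := Hmodel hx.
have psis : psi (xk t k) (sk t k) \is a fin_num.
  rewrite -(m_quad_fin_num f _ _ _ (Bk t k)).
  rewrite fin_numE; apply/andP; split.
    by rewrite /m_quad; move: (psiNy (sk t k)); case: (psi _ _).
  rewrite -ltey (le_lt_trans le_m) // ltey_eq.
  by rewrite m_quad_fin_num psis1.
split=> //; rewrite -(objective_fin_num f).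
have := Hubd k; rewrite -(m_quad_fin_num f _ _ _ (Bk t k)) in psis.
by case: (m_quad _ _ _ _ _) psis => // m _; case: (objective _ _ _).
Qed.

(** The three claims share one induction, since finiteness at the next iterate needs feasibility and
    a positive radius at the current one. *)
Lemma run_feasible k :
  [/\ box l u (xk t k), 0 < Deltak t k & h (xk t k) \is a fin_num].
Proof.
have [_ [g3 g31] [_ /andP[g3_gt1 _]] [Dmax0 _] _] := Hconst.
elim: k => [|k [bx D0 hx]].
  by have [bx hx] := run_init Hrun; have /andP[D0 _] := run_radius0 Hrun.
have [_ hxs] := trial_step_fin_num bx D0 hx.
have [bxs _ _] := run_trial Hrun k.
rewrite (run_iterate Hrun); split; [by case: ifP| |by case: ifP].
have [Dbar HD ->] := run_radius Hrun k.
rewrite lt_min Dmax0 andbT.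
have g1 : 0 < gamma1 c by lra.
have g1D : 0 < gamma1 c * Deltak t k by rewrite mulr_gt0.
have g2D : gamma1 c * Deltak t k <= gamma2 c * Deltak t k.
  by rewrite ler_pM2r //; lra.
have g3D : 0 < gamma3 c * Deltak t k by rewrite mulr_gt0 //; lra.
by move: HD; case: ifP => _; [|case: ifP => _]; lra.
Qed.

Lemma objective_run k : objective f h (xk t k) = (F k)%:E.
Proof. by rewrite fineK // objective_fin_num; have [] := run_feasible k. Qed.

Hypothesis Hmdc : forall k,
  (kmdc%:E * xik f h psi t k
    <= m_quad f psi 0%R (xk t k) (Bk t k)
       - m_quad f psi (sk t k) (xk t k) (Bk t k))%E.

(** Moves each iteration from extended reals to reals: [dm] is the decrease predicted by the model
    and [dF] the actual decrease. *)
Lemma iteration_values k : exists xi dm dF : R,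
  [/\ xik f h psi t k = xi%:E,
        2^-1 * (nuk t k)^-1 * enorm (s1k t k) ^+ 2 <= xi,
        kmdc * xi <= dm,
        `|dF - dm| <=
          kubd * (1 + spectral_norm (Bk t k)) * enorm (sk t k) ^+ 2 &
        rhok f h psi t k = (dF%:E / dm%:E)%E /\
        objective f h (xk t k + sk t k) = (F k - dF)%:E].
Proof.
have [bx D0 hx] := run_feasible k.
have [psis hxs] := trial_step_fin_num bx D0 hx.
have [_ [xi xiE le_xi]] :=
  cauchy_step_decrease Hmodel hx bx (ltW D0) (run_cauchy Hrun k).
have [_ _ p0 _] := Hmodel hx.
have := Hubd k; have := Hmdc k; rewrite /rhok /rho_ratio (m_quad0 _ _ p0) objective_run.
rewrite -(objective_fin_num f) in hxs.
rewrite -(m_quad_fin_num f _ _ _ (Bk t k)) in psis.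
case: (objective f h (xk t k + _)) hxs => // Fs _.
case: (m_quad _ _ _ _ _) psis => // ms _.
rewrite /xik xiE -EFinM -!EFinB lee_fin => le_dm; rewrite lee_fin => le_ubd.
exists xi, (F k - ms), (F k - Fs); split=> //; last by rewrite subKr.
have -> : F k - Fs - (F k - ms) = ms - Fs by ring.
by rewrite distrC.
Qed.


(** * Lower bound on the trust-region radius *)

Hypothesis Hkmdc : 0 < kmdc.
Hypothesis Hkubd : 0 < kubd.
Hypothesis Hnu : forall k, nuk t k = nu_max c t k.

Lemma nuk_gt0 k : 0 < nuk t k.
Proof. by have /andP[] := run_nu Hrun k. Qed.

Lemma alphaD_gt0 k : 0 < alpha c * Deltak t k.
Proof.
have [_ _ _ [_ a0] _] := Hconst.
by have [_ D0 _] := run_feasible k; rewrite mulr_gt0.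
Qed.

Lemma Delta_succ_gt0 : 0 < Delta_succ c kmdc kubd.
Proof.
have [[_ e2] _ _ [_ a0] b1] := Hconst.
by rewrite /Delta_succ divr_gt0 ?mulr_gt0 ?exprn_gt0 //; lra.
Qed.

Lemma Delta_min_gt0 : 0 < Delta_min c t kmdc kubd.
Proof.
have [_ [g3 g31] _ _ _] := Hconst; have [_ D0 _] := run_feasible 0.
rewrite /Delta_min lt_min D0 mulr_gt0 ?Delta_succ_gt0 //; lra.
Qed.

(** A positive denominator avoids the convention [0^-1 = +oo]. *)
Lemma rho_ge (dF dm e : R) : 0 < dm ->
  (e%:E <= dF%:E / dm%:E)%E = (e * dm <= dF).
Proof. by move=> dm0; rewrite inver gt_eqF // -EFinM lee_fin ler_pdivlMr. Qed.

Lemma small_radius_very_successful k : (0 < xik f h psi t k)%E ->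
  Deltak t k <= Delta_succ c kmdc kubd -> very_successful f h psi c t k.
Proof.
have [xi [dm [dF [-> le_xi le_dm le_dF [rhoE _]]]]] := iteration_values k.
rewrite lte_fin => xi0.
have [[_ e2] _ _ [_ a0] b1] := Hconst.
have kxi : 0 < kmdc * xi by rewrite mulr_gt0 //; lra.
have dm0 : 0 < dm by lra.
have bt0 : 0 < beta c by lra.
have b2 : 0 < beta c ^+ 2 by rewrite exprn_gt0.
rewrite /Delta_succ ler_pdivlMr ?mulr_gt0 // => leD.
rewrite /very_successful rhoE rho_ge //.
have nu0 := nuk_gt0 k.
have B0 := spectral_norm_ge0 (Bk t k).
(* The trial step is at most [beta] times the Cauchy step, whose squared norm is at most
   [2 * nu * xi] by the Cauchy decrease. *)
have le_s : enorm (sk t k) ^+ 2 <= beta c ^+ 2 * (2 * nuk t k * xi).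
  have [_ + _] := run_trial Hrun k; rewrite le_min => /andP[_ le_s].
  have le_s1 : enorm (s1k t k) ^+ 2 <= 2 * nuk t k * xi.
    move: le_xi; by rewrite -mulrA ler_pdivrMl // ler_pdivrMl // mulrCA mulrA.
  apply: le_trans (_ : (beta c * enorm (s1k t k)) ^+ 2 <= _).
    by rewrite ler_sqr ?nnegrE ?mulr_ge0 ?enorm_ge0 //; lra.
  by rewrite exprMn ler_pM2l.
have le_nu : nuk t k * (1 + spectral_norm (Bk t k)) <= alpha c * Deltak t k.
  by rewrite Hnu nu_max_le ?alphaD_gt0.
set b := spectral_norm _ in B0 le_nu le_dF *.
have kb0 : 0 <= kubd * (1 + b) by rewrite mulr_ge0 ?addr_ge0 // ltW.
have w0 : 0 <= 2 * kubd * beta c ^+ 2 * xi by rewrite !mulr_ge0 // ltW.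
(* These four inequalities chain the model error to [2 * kubd * beta^2 * alpha * Delta * xi], then
   to [(1 - eta2) * kmdc * xi], then to [(1 - eta2) * dm]; hence the ratio is at least [eta2]. *)
have le1 := ler_wpM2l kb0 le_s.
have le2 := ler_wpM2r w0 le_nu.
have le3 := ler_wpM2r (ltW xi0) leD.
have e20 : 0 <= 1 - eta2 c by lra.
have le4 := ler_wpM2r e20 le_dm.
have : `|dF - dm| <= (1 - eta2 c) * dm by lra.
by rewrite ler_norml; lra.
Qed.

(** Below [Delta_succ] the step is very successful and the candidate radius grows; above it one
    update shrinks the radius by a factor [gamma1] at worst. The cap [Delta_max] exceeds the initial
    radius, hence also [Delta_min]. *)
Lemma Delta_min_le k : (forall j, (j < k)%N -> (0 < xik f h psi t j)%E) ->
  Delta_min c t kmdc kubd <= Deltak t k.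
Proof.
have [_ [g3 g31] [g2 g4] _ _] := Hconst.
elim: k => [_|k IH xi0]; first by rewrite /Delta_min ge_min lexx.
have {}IH := IH (fun j ltjk => xi0 j (ltnW ltjk)).
have [_ D0 _] := run_feasible k.
have [Dbar HD ->] := run_radius Hrun k.
rewrite le_min; apply/andP; split; last first.
  by rewrite /Delta_min ge_min; have /andP[_ /ltW ->] := run_radius0 Hrun.
have g2D : gamma1 c * Deltak t k <= gamma2 c * Deltak t k.
  by rewrite ler_pM2r //; lra.
have g3D : 1 * Deltak t k <= gamma3 c * Deltak t k by rewrite ler_pM2r //; lra.
have g3D' : gamma2 c * Deltak t k <= 1 * Deltak t k by rewrite ler_pM2r //; lra.
have [leD|ltD] := leP (Deltak t k) (Delta_succ c kmdc kubd).
  by move: HD; rewrite small_radius_very_successful ?xi0 //; lra.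
rewrite /Delta_min ge_min; apply/orP; right.
have g1D : gamma1 c * Delta_succ c kmdc kubd <= gamma1 c * Deltak t k.
  by rewrite ler_pM2l 1?ltW //; lra.
by move: HD; case: ifP => _; [|case: ifP => _]; lra.
Qed.

(** * Decrease of the objective in one successful iteration *)

Lemma noncritical_xi k (eps : R) : 0 < eps -> (eps%:E < critk f h psi t k)%E ->
  ((nuk t k * eps ^+ 2)%:E < xik f h psi t k)%E.
Proof.
move=> eps0; rewrite /critk /criticality -/(xik f h psi t k).
have [xi [dm [dF [-> le_xi _ _ _]]]] := iteration_values k.
have nu0 := nuk_gt0 k.
(* Nonnegativity of [xi] allows its square root to be squared back. *)
have xi0 : 0 <= xi.
  apply: le_trans le_xi; apply: mulr_ge0; last exact: sqr_ge0.
  by rewrite mulr_ge0 // invr_ge0 ltW.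
rewrite poweR_EFin -EFinM !lte_fin powRN !powR12_sqrt // ?ltW //.
rewrite ltr_pdivlMl ?sqrtr_gt0 // => lt_sqrt.
rewrite -[ltRHS](sqr_sqrtr xi0) -[X in X * _](sqr_sqrtr (ltW nu0)) -exprMn.
by rewrite ltr_sqr ?nnegrE ?mulr_ge0 ?sqrtr_ge0 // ltW.
Qed.

Lemma successful_decrease k (eps : R) : 0 < eps ->
    (eps%:E < critk f h psi t k)%E -> successful f h psi c t k ->
  F k.+1 <= F k - eta1 c * kmdc * (nuk t k * eps ^+ 2).
Proof.
move=> eps0 /(noncritical_xi eps0).
have [xi [dm [dF [-> _ le_dm _ [rhoE FE]]]]] := iteration_values k.
rewrite lte_fin => lt_xi sk_succ.
have [[e1 _] _ _ _ _] := Hconst.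
have nu0 : 0 < nuk t k * eps ^+ 2 by rewrite mulr_gt0 ?nuk_gt0 ?exprn_gt0.
have k0 := Hkmdc.
have dm_ge : kmdc * (nuk t k * eps ^+ 2) <= dm.
  by apply: le_trans le_dm; rewrite ler_pM2l // ltW.
have dm0 : 0 < dm by apply: lt_le_trans dm_ge; rewrite mulr_gt0.
have -> : F k.+1 = F k - dF.
  by rewrite [LHS]/F (run_iterate Hrun) sk_succ FE.
move: sk_succ; rewrite /successful rhoE rho_ge // => le_dF.
rewrite lerD2l lerN2 -mulrA; apply: le_trans le_dF.
by rewrite ler_pM2l.
Qed.

Lemma unsuccessful_stationary k : ~~ successful f h psi c t k -> F k.+1 = F k.
Proof. by move=> /negbTE Nsucc; rewrite /F (run_iterate Hrun) Nsucc. Qed.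

(** * Summation over the successful iterations *)

Lemma sigmakE k :
  sigmak f h psi c t k = count (successful f h psi c t) (iota 0 k.+1).
Proof.
rewrite /sigmak cardsE -sum1_card big_mkcond /=.
rewrite -(big_mkord xpredT (fun j => if successful f h psi c t j then 1 else 0))%N.
by rewrite /index_iota subn0 -big_mkcond /= sum1_count.
Qed.

Lemma iterated_decrease (delta : R) k :
    (forall j, (j < k)%N -> successful f h psi c t j -> F j.+1 <= F j - delta) ->
  F k <= F 0 - (count (successful f h psi c t) (iota 0 k))%:R * delta.
Proof.
elim: k => [_|k IH dec]; first by rewrite mul0r subr0.
have {}IH := IH (fun j ltjk => dec j (ltnW ltjk)).
rewrite -addn1 iotaD count_cat /= add0n addn0 natrD mulrDl addn1.
case: (boolP (successful f h psi c t k)) => [succk|/unsuccessful_stationary ->].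
  by have := dec k (ltnSn k) succk; rewrite mul1r; lra.
by rewrite mul0r addr0.
Qed.

(** Stated at a single index [k] up to which no iteration is critical, so that it applies before
    [S_eps] is known to be finite. *)
Lemma sigmak_bound (mu p low eps : R) k :
    0 < mu -> 0 < p < 1 -> 0 < eps ->
    (forall j, (j <= k)%N -> spectral_norm (Bk t j)
       <= mu * (1 + (sigmak f h psi c t k)%:R `^ p)) ->
    low <= F k.+1 ->
    (forall j, (j <= k)%N -> (eps%:E < critk f h psi t j)%E) ->
    mu + 1 <= mu * (sigmak f h psi c t k)%:R `^ p ->
  (sigmak f h psi c t k)%:R <=
    (2 * mu * (1 + (alpha c)^-1 * (Delta_min c t kmdc kubd)^-1)
      * ((F 0 - low) / (eta1 c * kmdc * eps ^+ 2))) `^ (1 / (1 - p)).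
Proof.
move=> mu0 /andP[p0 p1] eps0 HB le_low crit.
set M := (sigmak f h psi c t k)%:R => le_mu; rewrite -/M in HB.
set q := 1 + _; set w := eta1 c * kmdc * eps ^+ 2.
have [[e1 _] _ _ [_ a0] _] := Hconst.
have Dm0 := Delta_min_gt0.
have aD0 : 0 < alpha c * Delta_min c t kmdc kubd by rewrite mulr_gt0.
have qE : q = 1 + (alpha c * Delta_min c t kmdc kubd)^-1 by rewrite invfM.
have q0 : 0 < q by rewrite qE addr_gt0 ?invr_gt0.
have w0 : 0 < w by rewrite !mulr_gt0 ?exprn_gt0.
have eps20 : 0 < eps ^+ 2 by rewrite exprn_gt0.
have xi0 j : (j <= k)%N -> (0 < xik f h psi t j)%E.
  move=> lejk; apply: lt_trans (noncritical_xi eps0 (crit j lejk)).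
  by rewrite lte_fin mulr_gt0 ?nuk_gt0.
have Mp0 : 0 < M `^ p.
  rewrite lt_neqAle powR_ge0 andbT eq_sym; apply/negP => /eqP Mp.
  by move: le_mu; rewrite Mp mulr0; lra.
have M0 : 0 < M by apply: gt0_powR p0 _ Mp0; rewrite ler0n.
set b0 := mu * (1 + M `^ p) in HB *.
have b00 : 0 < b0 by rewrite mulr_gt0 // addr_gt0.
(* [le_mu] absorbs [1 + mu] into a second copy of [mu * M^p]. *)
have b0_le : 1 + b0 <= 2 * mu * M `^ p by rewrite /b0; lra.
(* [b0] bounds the matrix norms at all iterations up to [k], so this bound is uniform in [j]. *)
have nu_ge j : (j <= k)%N -> ((1 + b0) * q)^-1 <= nuk t j.
  move=> lejk; rewrite Hnu qE; apply: nu_max_ge; last by rewrite spectral_norm_ge0 HB.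
  rewrite aD0 ler_pM2l //; apply: Delta_min_le => i ltij.
  by rewrite xi0 // ltnW // (leq_trans ltij).
(* [sigmak k] counts iteration [k] itself, so the telescoping ends at [F k.+1]. *)
have := @iterated_decrease (w * ((1 + b0) * q)^-1) k.+1.
rewrite -sigmakE -/M => dec.
have {}dec : F k.+1 <= F 0 - M * (w * ((1 + b0) * q)^-1).
  apply: dec => j; rewrite ltnS => lejk succj.
  have := successful_decrease eps0 (crit j lejk) succj.
  have := ler_wpM2l (ltW w0) (nu_ge j lejk); rewrite /w; lra.
have bq0 : 0 < (1 + b0) * q by rewrite mulr_gt0 // addr_gt0.
have {dec} le_Mw : M * w <= (F 0 - low) * ((1 + b0) * q).
  by rewrite -ler_pdivrMr // -mulrA; lra.
have FL : 0 <= F 0 - low.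
  rewrite -(pmulr_lge0 _ bq0); apply: le_trans le_Mw.
  by rewrite mulr_ge0 // ltW.
(* Dividing by [M^p] moves the growth of the matrix norms to the left-hand side. *)
have le_M1p : M `^ (1 - p) <= 2 * mu * q * ((F 0 - low) / w).
  rewrite powRB; last by rewrite gt_eqF // implybT.
  rewrite powRr1 ?(ltW M0) // ler_pdivrMr // mulrA mulrAC ler_pdivlMr //.
  apply: le_trans le_Mw _.
  have := ler_wpM2l (mulr_ge0 FL (ltW q0)) b0_le; lra.
have {1}-> : M = (M `^ (1 - p)) `^ (1 / (1 - p)).
  by rewrite -powRrM mulrC divfK ?powRr1 ?(ltW M0) // gt_eqF // subr_gt0.
have r0 : 0 <= 1 / (1 - p) by rewrite divr_ge0 // subr_ge0 ltW.
have B0 : 0 <= 2 * mu * q * ((F 0 - low) / w).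
  by apply: le_trans le_M1p; rewrite powR_ge0.
apply: (ge0_ler_powR r0) le_M1p; rewrite nnegrE ?powR_ge0 //.
Qed.

(** * From single indices to the set [S_eps] *)

Lemma k_eps_noncritical (eps : R) k j :
    (k%:R%:E < k_eps f h psi t eps)%E -> (j <= k)%N ->
  (eps%:E < critk f h psi t j)%E.
Proof.
move=> ltk lejk; rewrite ltNge; apply/negP => critj.
have : (k_eps f h psi t eps <= j%:R%:E)%E.
  by apply: ereal_inf_lbound; exists j.
by move=> /(lt_le_trans ltk); rewrite lte_fin ltr_nat ltnNge lejk.
Qed.

(** Take the largest entry for [k]. That [k] is an entry matters: for entries in [S_eps] it places
    [k] before [k_eps], so [sigmak_bound] applies there. *)
Lemma size_le_sigmak (s : seq nat) : uniq s -> s != [::] ->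
    {in s, forall j, successful f h psi c t j} ->
  exists2 k, k \in s & (size s <= sigmak f h psi c t k)%N.
Proof.
move=> us s0 succs.
have [k ks maxk] : exists2 k, k \in s & {in s, forall j, (j <= k)%N}.
  exists (\max_(j <- s) j); last by move=> j js; apply: leq_bigmax_seq.
  case: s s0 {us succs} => // a s _; elim: s a => [a|b s IH a].
    by rewrite big_seq1 inE.
  rewrite big_cons /maxn; case: ifP => _; last by rewrite inE eqxx.
  by rewrite inE IH orbT.
exists k => //; rewrite sigmakE -size_filter uniq_leq_size // => j js.
by rewrite mem_filter succs // mem_iota /= add0n ltnS maxk.
Qed.

End Run.

Lemma powR_sqr_bigO {R : realType} (A r : R) : 0 <= A -> 0 <= r ->
  (fun eps : R => (A * (eps ^+ 2)^-1) `^ r) =O_ (0^'+)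
    (fun eps : R => eps `^ (- (2 * r))).
Proof.
move=> A0 r0; apply/eqO_exP; exists (A `^ r + 1).
  (* The added 1 keeps the constant positive even when the power of [A] vanishes. *)
  by rewrite ltr_wpDl ?powR_ge0.
near=> eps.
have eps0 : 0 < eps by near: eps; exact: nbhs_right_gt.
have -> : (A * (eps ^+ 2)^-1) `^ r = A `^ r * eps `^ (- (2 * r)).
  by rewrite powRM ?invr_ge0 ?sqr_ge0 // -powR_invn ?ltW // -powRrM mulNr.
rewrite ger0_norm ?mulr_ge0 ?powR_ge0 // [leRHS]mulrDl mul1r.
by rewrite ger0_norm ?powR_ge0 // lerDl powR_ge0.
Unshelve. all: by end_near.
Qed.

Theorem lemma3p3 (R : realType) (n : nat)
    (f : 'cV[R]_n -> R) (h : 'cV[R]_n -> \bar R) (l u : 'I_n -> \bar R)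
    (psi : 'cV[R]_n -> 'cV[R]_n -> \bar R)
    (c : tr_constants R) (t : tr_sequences R n)
    (kmdc kubd mu p low : R)
    (Hproblem : problem_assumptions f h l u)
    (Hmodel : model_assumptions h psi)
    (Hconst : admissible_constants c)
    (Hrun : tr_run f h l u psi c t)
    (Hnu : forall k, nuk t k = nu_max c t k)
    (Hkmdc : 0 < kmdc < 1)
    (Hmdc : forall k,
       (kmdc%:E * xik f h psi t k
         <= m_quad f psi 0%R (xk t k) (Bk t k)
            - m_quad f psi (sk t k) (xk t k) (Bk t k))%E)
    (Hkubd : 0 < kubd)
    (Hubd : forall k,
       (`| objective f h (xk t k + sk t k)%R
           - m_quad f psi (sk t k) (xk t k) (Bk t k) |
         <= (kubd * (1 + spectral_norm (Bk t k)) * enorm (sk t k) ^+ 2)%:E)%E)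
    (Hmu : 0 < mu) (Hp : 0 < p < 1)
    (HB : forall k,
       \big[Num.max/0]_(j < k.+1) spectral_norm (Bk t j)
         <= mu * (1 + (sigmak f h psi c t k)%:R `^ p))
    (Hinf : infinite_set [set k | successful f h psi c t k])
    (Hlow : forall k, (low%:E <= objective f h (xk t k))%E) :
  let S := S_eps f h psi c t in
  let bound := fun eps : R =>
    (2 * mu * (1 + (alpha c)^-1 * (Delta_min c t kmdc kubd)^-1)
      * ((fine (objective f h (xk t 0%N)) - low) / (eta1 c * kmdc * eps ^+ 2)))
    `^ (1 / (1 - p)) in
  (forall eps : R, 0 < eps < 1 ->
     ((mu + 1)%:E <= mu%:E * poweR (counting (S eps)) p)%E ->
     (counting (S eps) <= (bound eps)%:E)%E)
  /\ bound =O_ (0^'+) (fun eps : R => eps `^ (- (2 / (1 - p)))).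
Proof.
have k0 : 0 < kmdc by case/andP: Hkmdc.
have FE := objective_run Hmodel Hconst Hrun Hubd.
have [p0 p1] := andP Hp.
move=> S bound; split=> [eps /andP[eps0 _] le_mu|].
  (* Bounding every finite list drawn from [S eps] settles the finite case and also refutes the
     infinite one. *)
  have size_le (s : seq nat) : uniq s -> {in s, forall j, S eps j} ->
      mu + 1 <= mu * (size s)%:R `^ p -> (size s)%:R <= bound eps.
    move=> us sS le_s.
    have s0 : s != [::].
      by apply: contraTneq le_s => ->; rewrite powR0 ?gt_eqF // mulr0; lra.
    have [k ks le_k] :=
      size_le_sigmak us s0 (fun j js => (sS j js).2 : successful f h psi c t j).
    have {}le_k : (size s)%:R <= (sigmak f h psi c t k)%:R :> R by rewrite ler_nat.
    apply: (le_trans le_k).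
    apply: (sigmak_bound Hmodel Hconst Hrun Hubd Hmdc k0 Hkubd Hnu Hmu Hp eps0).
    - move=> j lejk; apply: le_trans (HB k).
      exact: (le_bigmax 0 (fun j : 'I_k.+1 => spectral_norm (Bk t j))
        (Ordinal (lejk : (j < k.+1)%N))).
    - by rewrite -lee_fin -FE.
    - move=> j; exact: k_eps_noncritical (sS k ks).1.
    - apply: le_trans le_s _; rewrite ler_pM2l //.
      by rewrite (ge0_ler_powR (ltW p0)) ?nnegrE ?ler0n.
  move: le_mu; rewrite /counting; case: asboolP => [finS|infS _].
    rewrite poweR_EFin -EFinM !lee_fin => le_mu; apply: size_le => //.
      exact: finmap.fset_uniq.
    by move=> j; rewrite in_fset_set // inE.
  (* For infinite [S eps], [N.+1] exceeds both the claimed bound and the size from which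
     [mu + 1 <= mu * size^p]; a finite subset that large contradicts [size_le]. *)
  pose N := Num.truncn (Num.max (((mu + 1) / mu) `^ p^-1) (bound eps)).
  have [A AS leA] := infinite_set_fset N.+1 infS.
  have ltA : Num.max (((mu + 1) / mu) `^ p^-1) (bound eps) < (size (finmap.enum_fset A))%:R.
    by apply: lt_le_trans (truncnS_gt _) _; rewrite ler_nat.
  move: ltA; rewrite gt_max => /andP[ltA1 ltA2].
  have : (size (finmap.enum_fset A))%:R <= bound eps.
    apply: size_le; [exact: finmap.fset_uniq|by move=> j jA; apply: AS|].
    rewrite mulrC -ler_pdivrMr //.
    have -> : (mu + 1) / mu = (((mu + 1) / mu) `^ p^-1) `^ p.
      by rewrite -powRrM mulVf ?gt_eqF // powRr1 // divr_ge0 ?addr_ge0 ?ltW.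
    apply: (ge0_ler_powR (ltW p0)); rewrite ?nnegrE ?powR_ge0 ?ler0n //; exact: ltW.
  by rewrite leNgt ltA2.
(* [A] collects the factors of the bound that do not depend on [eps]. *)
set A := 2 * mu * (1 + (alpha c)^-1 * (Delta_min c t kmdc kubd)^-1)
  * ((fine (objective f h (xk t 0%N)) - low) / (eta1 c * kmdc)).
have -> : bound = fun eps => (A * (eps ^+ 2)^-1) `^ (1 / (1 - p)).
  by apply/funext => eps; rewrite /bound /A invfM !mulrA.
have -> : 2 / (1 - p) = 2 * (1 / (1 - p)) by rewrite mul1r.
have [[e1 _] _ _ [_ a0] _] := Hconst.
have Dm0 := Delta_min_gt0 Hmodel Hconst Hrun Hubd k0 Hkubd.
apply: powR_sqr_bigO; last by rewrite divr_ge0 // subr_ge0 ltW.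
have FL : 0 <= fine (objective f h (xk t 0)) - low.
  by rewrite subr_ge0 -lee_fin -FE.
have q0 : 0 <= 1 + (alpha c)^-1 * (Delta_min c t kmdc kubd)^-1.
  by rewrite addr_ge0 ?mulr_ge0 ?invr_ge0 ?ltW.
by rewrite /A mulr_ge0 ?divr_ge0 ?mulr_ge0 ?(ltW e1) ?(ltW k0) ?(ltW Hmu).
Qed.
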